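(* Let $k>2$ and $r\ge1$ be integers and let $D=D_{2^k(2r+1)}=\langle x,y\mid x^{2^k}=1,\ y^{2r+1}=1,\ xyx^{-1}=y^{-1}\rangle$, with natural representation $\rho_{\mathrm{Nat}}=\varrho_{1,1}$. The McKay quiver $Q_{\rho_{\mathrm{Nat}}}(D)$ has as vertices the irreducible representations $\alpha_i$, $0\le i\le 2^k-1$, and $\varrho_{t,s}$, $1\le t\le 2r$, $0\le s\le 2^{k-2}-1$, and its arrows are exactly the following (each with multiplicity one; indices of $\alpha$ are taken modulo $2^k$). (1) From $\alpha_i$ there is exactly one arrow, namely: - $\alpha_i\to\varrho_{1,i+1}$ if $i=0,\dots,2^{k-2}-2$; - $\alpha_i\to\varrho_{2r,j}$ if $i=2^{k-2}+j-1$ with $j=0,\dots,2^{k-2}-1$; - $\alpha_i\to\varrho_{1,j}$ if $i=2^{k-1}+j-1$ with $j=0,\dots,2^{k-2}-1$; - $\alpha_i\to\varrho_{2r,j}$ if $i=3\cdot2^{k-2}+j-1$ with $j=0,\dots,2^{k-2}-1$; - $\alpha_{2^k-1}\to\varrho_{1,0}$. (2) From $\varrho_{1,s}$ there are exactly three arrows: to $\alpha_{s+1}$, to $\alpha_{2^{k-1}+s+1}$, and to $\varrho_{2,s+1}$, where for $s=2^{k-2}-1$ the last target is to be read as $\varrho_{2,2^{k-2}}\cong\varrho_{2r-1,0}$. (3) If $t\ne1$ and $t\neq 2r$, from $\varrho_{t,s}$ there are exactly two arrows: to $\varrho_{t-1,s+1}$ and to $\varrho_{t+1,s+1}$, where for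 $s=2^{k-2}-1$ these targets are to be read as $\varrho_{t-1,2^{k-2}}\cong\varrho_{2r+1-(t-1),0}$ and $\varrho_{t+1,2^{k-2}}\cong\varrho_{2r+1-(t+1),0}$. (4) From $\varrho_{2r,s}$ there are exactly three arrows: to $\alpha_{2^{k-2}+s+1}$, to $\alpha_{2^{k-1}+2^{k-2}+s+1}$, and to $\varrho_{2r-1,s+1}$, where for $s=2^{k-2}-1$ the last target is to be read as $\varrho_{2r-1,2^{k-2}}\cong\varrho_{2,0}$.
   Context: For a finite group $G$ with complex irreducible representations $\rho_0,\dots,\rho_n$ (up to isomorphism) and a complex representation $\rho$ of $G$, write $\rho\otimes\rho_i\cong\bigoplus_j a_{ij}\rho_j$. The McKay quiver $Q_\rho(G)$ has one vertex for each $\rho_i$ and $a_{ij}$ arrows from the vertex $\rho_i$ to the vertex $\rho_j$. Put $\zeta_n=e^{2\pi i/n}$. The group $D_{2^k(2r+1)}$ has order $2^k(2r+1)$. Its one-dimensional representations $\alpha_j$ (index modulo $2^k$) are $\alpha_j(x)=\zeta_{2^k}^j$, $\alpha_j(y)=1$. For integers $t,s$, the two-dimensional representation $\varrho_{t,s}$ is $$\varrho_{t,s}(x)=\zeta_{2^k}^s\begin{pmatrix}0&1\\(-1)^t&0\end{pmatrix},\qquad \varrho_{t,s}(y)=\begin{pmatrix}\zeta_{2r+1}^t&0\\0&\zeta_{2r+1}^{-t}\end{pmatrix}.$$ A complete list of pairwise non-isomorphic irreducible representations is $\alpha_j$ ($0\le j\le 2^k-1$) together with $\varrho_{t,s}$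 ($1\le t\le 2r$, $0\le s\le 2^{k-2}-1$). The natural representation is $\varrho_{1,1}$ (when $s=1$ is outside the chosen range of indices it is understood up to isomorphism, using $\varrho_{2r+1-t,s}\cong\varrho_{t,2^{k-2}+s}$). *)

(* Defs.v *)
From mathcomp Require Import all_boot all_order all_algebra.
From mathcomp Require Import all_fingroup all_solvable all_field all_character.
From mathcomp Require Import reals trigo.
From mathcomp Require Import complex.

Set Implicit Arguments.
Unset Strict Implicit.
Unset Printing Implicit Defensive.

Import Order.TTheory GRing.Theory Num.Theory.
Local Open Scope ring_scope.

Section McKay.
Variables (F : fieldType) (gT : finGroupType) (G : {group gT}).
Variables (I : finType) (irreps : I -> representation F G).

Definition complete_irreps : Prop :=
  [/\ forall i, mx_irreducible (irreps i),
      forall i j, mx_rsim (irreps i) (irreps j) -> i = j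
    & forall n (rG : mx_representation F G n),
        mx_irreducible rG -> exists i, mx_rsim rG (irreps i)].

(* [a i j] is the number of arrows from the vertex [i] to the vertex [j]. *)
Definition mckay_quiver n (rho : mx_representation F G n)
    (a : I -> I -> nat) : Prop :=
  forall i, mx_rsim (prod_repr rho (irreps i))
              (\big[dadd_grepr/grepr0]_(j : I) muln_grepr (irreps j) (a i j)).

End McKay.

(* In the finite group D, any pair of generators satisfying the relations      *)
(* induces, by counting, an isomorphism from the presented group onto D, so    *)
(* the first conjunct makes the relations on x and y defining ones.            *)
Definition D_presentation (k r : nat) (gT : finGroupType) (D : {group gT})
    (x y : gT) : Prop :=
  [/\ (D \isog Grp (X : Y : X ^+ (2 ^ k), Y ^+ (2 * r).+1, X * Y * X^-1 = Y^-1))%g,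
      <<[set x; y]>>%g = D
    & [/\ (x ^+ (2 ^ k) = 1)%g, (y ^+ (2 * r).+1 = 1)%g
        & (x * y * x^-1 = y^-1)%g]].

Section Representations.
Variables (R : realType) (k r : nat) (gT : finGroupType) (D : {group gT}).
Variables (x y : gT).

Definition zeta (n : nat) : R[i] :=
  (cos (2 * pi / n%:R) +i* sin (2 * pi / n%:R))%C.

Definition mx22 (a b c d : R[i]) : 'M[R[i]]_2 :=
  \matrix_(i < 2, j < 2)
    if i == 0 then if j == 0 then a else b else if j == 0 then c else d.

(* A representation of D is determined on D by its values at x and y. *)
Definition is_alpha (alpha : nat -> mx_representation R[i] D 1) : Prop :=
  forall j, alpha j x = (zeta (2 ^ k) ^+ j)%:M /\ alpha j y = 1%:M.

Definition is_varrho (varrho : nat -> nat -> mx_representation R[i] D 2) : Prop :=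
  forall t s,
    varrho t s x = zeta (2 ^ k) ^+ s *: mx22 0 1 ((-1) ^+ t) 0 /\
    varrho t s y = mx22 (zeta (2 * r).+1 ^+ t) 0 0 (zeta (2 * r).+1 ^- t).

End Representations.

(* [inr (t, s)] stands for varrho_{t+1,s}, since ordinals start at 0. *)
Definition vertex (k r : nat) : finType :=
  ('I_(2 ^ k) + 'I_(2 * r) * 'I_(2 ^ (k - 2)))%type.

Definition vertex_irrep (F : fieldType) (gT : finGroupType) (D : {group gT})
    (k r : nat) (alpha : nat -> mx_representation F D 1)
    (varrho : nat -> nat -> mx_representation F D 2) (v : vertex k r) :
    representation F D :=
  match v with
  | inl i => Representation (alpha i)
  | inr (t, s) => Representation (varrho t.+1 s)
  end.

(* The subscripts i of alpha_i, resp. (t, s) of varrho_{t,s}. *)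
Definition label : eqType := (nat + nat * nat)%type.
Definition Alpha (i : nat) : label := inl i.
Definition Varrho (t s : nat) : label := inr (t, s).

Definition vertex_label (k r : nat) (v : vertex k r) : label :=
  match v with
  | inl i => Alpha i
  | inr (t, s) => Varrho t.+1 s
  end.

Definition arrows_from (k r : nat) (a : vertex k r -> vertex k r -> nat)
    (src : label) (targets : seq label) : Prop :=
  forall v w, vertex_label v = src ->
    a v w = count_mem (vertex_label w) targets.

(* Such D, alpha and varrho exist: see D_presentation_exists, is_alpha_exists  *)
(* and is_varrho_exists.                                                       *)

Lemma zetaX (R : realType) n i :
  zeta R n ^+ i = (cos (2 * pi / n%:R *+ i) +i* sin (2 * pi / n%:R *+ i))%C.
Proof.
elim: i => [|i IH]; first by rewrite expr0 !mulr0n cos0 sin0.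
rewrite exprS IH /zeta !mulrS cosD sinD.
set c := cos _; set s := sin _; set c' := cos _; set s' := sin _.
have -> : s * c' + c * s' = c * s' + s * c' by rewrite addrC.
by [].
Qed.

Lemma zetaXn (R : realType) n : (0 < n)%N -> zeta R n ^+ n = 1.
Proof.
move=> n0; rewrite zetaX -mulr_natr divfK ?pnatr_eq0 -?lt0n //.
by rewrite -[2]/(2%:R) mulr_natl cos2pi sin2pi.
Qed.

Lemma hom_swap (p q : nat) (gT : finGroupType) (G : {group gT}) :
  (G \homg Grp (X : Y : X ^+ p, Y ^+ q, X * Y * X^-1 = Y^-1))%g =
  (G \homg Grp (x : y : x ^+ q, y ^+ p, x ^ y = x^-1))%g.
Proof.
have relE (a b : gT) : (b * a * b^-1 == a^-1)%g = (a ^ b == a^-1)%g.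
  have -> : (b * a * b^-1 = a ^ b^-1)%g by rewrite conjgE invgK mulgA.
  apply/eqP/eqP => h; first by rewrite -[RHS](conjgKV b) conjVg h invgK.
  by rewrite -[RHS](conjgK b) conjVg h invgK.
apply/existsP/existsP => -[[u v]]; rewrite /= !xpair_eqE => /and4P[g a b c];
  exists (v, u); rewrite /= !xpair_eqE joingC g a b /=; first by rewrite -relE.
by rewrite relE.
Qed.

Lemma D_model k r : (0 < k)%N -> (0 < r)%N ->
  exists (gT : finGroupType) (D : {group gT}), #|D| = (2 ^ k * (2 * r).+1)%N /\
   (D \isog Grp (X : Y : X ^+ (2 ^ k), Y ^+ (2 * r).+1, X * Y * X^-1 = Y^-1))%g.
Proof.
move=> k0 r0.
have q1 : (1 < (2 * r).+1)%N by rewrite ltnS muln_gt0.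
have p1 : (1 < 2 ^ k)%N by rewrite -{1}(expn0 2) ltn_exp2l.
have ev : (2 %| 2 ^ k)%N by rewrite -(prednK k0) expnS dvdn_mulr.
have isoG := Grp_ext_dihedral q1 p1 ev.
exists (Extremal.gtype (2 * r).+1 (2 ^ k) (2 * r)), [set: _]%G; split.
  exact: Extremal.card.
by move=> rT H; rewrite hom_swap; apply: isoG.
Qed.

Lemma D_presentation_exists k r : (0 < k)%N -> (0 < r)%N ->
  exists (gT : finGroupType) (D : {group gT}) x y, D_presentation k r D x y.
Proof.
move=> k0 r0; have [gT [D [_ iD]]] := D_model k0 r0.
have := isoGrp_hom iD; case/existsP => -[x y]; rewrite /= !xpair_eqE.
case/and4P=> /eqP g /eqP a /eqP b /eqP c; exists gT, D, x, y; split=> //.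
by rewrite -g joing_idl joing_idr.
Qed.

Section ReprOfRelations.
Variables (k r : nat) (k0 : (0 < k)%N) (r0 : (0 < r)%N).
Variables (gT : finGroupType) (D : {group gT}) (x y : gT).
Hypothesis hD : D_presentation k r D x y.
Let N := (2 ^ k)%N.
Let m := (2 * r).+1.

Lemma D_facts : [/\ #[x]%g = N, #[y]%g = m, (<[y]> * <[x]> = D)%g &
  (<[y]> :&: <[x]> = 1)%g].
Proof.
case: hD => iD gD [xN ym rel].
have [hT [H [cH iH]]] := D_model k0 r0.
have le : (N * m <= #|D|)%N.
  rewrite /N /m -cH; apply: leq_homg; rewrite iD -iH; exact: homg_refl.
have nx : (x \in 'N(<[y]>))%g.
  rewrite -groupV inE -cycleJ conjgE invgK mulgA rel.
  by rewrite cycle_subG groupV cycle_id.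
have eD : (<[y]> * <[x]> = D)%g.
  by rewrite -norm_joinEr ?cycle_subG // joing_idl joing_idr -gD /joing setUC.
have dx : (#[x]%g <= N)%N by rewrite dvdn_leq ?expn_gt0 // order_dvdn xN.
have dy : (#[y]%g <= m)%N by rewrite dvdn_leq // order_dvdn ym.
have := mul_cardG <[y]>%G <[x]>%G; rewrite eD -!orderE => e.
have I0 := cardG_gt0 (<[y]> :&: <[x]>)%G.
have ox := order_gt0 x; have oy := order_gt0 y.
have N0 : (0 < N)%N by rewrite expn_gt0.
have i1 : #|(<[y]> :&: <[x]>)%g| = 1%N.
  apply/eqP; rewrite eqn_leq I0 andbT -(@leq_pmul2l #|D|) ?cardG_gt0 //.
  by rewrite -e muln1 (leq_trans _ le) // mulnC leq_mul.
move: e; rewrite i1 muln1 => e.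
have ex : #[x]%g = N.
  apply/eqP; rewrite eqn_leq dx -(@leq_pmul2l m) // (@leq_trans (#[y]%g * #[x]%g)) ?leq_mul2r ?dy ?orbT //.
  by rewrite e mulnC.
split=> //; last by apply/eqP; rewrite eq_sym eqEcard sub1G cards1 i1.
apply/eqP; rewrite eqn_leq dy -(@leq_pmul2r N) // -{2}ex e mulnC //.
Qed.

Variables (F : fieldType) (n : nat) (A B : 'M[F]_n.+1).
Hypotheses (AN : A ^+ N = 1) (Bm : B ^+ m = 1) (AB : A * B = B ^+ (2 * r) * A).

Definition D_repr_mx (g : gT) : 'M[F]_n.+1 :=
  if [pick p : 'I_m * 'I_N | g == (y ^+ p.1 * x ^+ p.2)%g] is Some p
  then B ^+ p.1 * A ^+ p.2 else 1.

Lemma modX (C : 'M[F]_n.+1) M i j : C ^+ M = 1 -> i = j %[mod M] -> C ^+ i = C ^+ j.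
Proof.
move=> C1 e; rewrite (divn_eq i M) (divn_eq j M) !exprD !(mulnC _ M) !exprM C1.
by rewrite !expr1n e.
Qed.

Lemma D_repr_mxE i j : D_repr_mx (y ^+ i * x ^+ j)%g = B ^+ i * A ^+ j.
Proof.
have [ox oy eD tI] := D_facts.
rewrite /D_repr_mx; case: pickP => [[a b] /= /eqP e|].
  have h : ((y ^+ a)^-1 * y ^+ i = x ^+ b * (x ^+ j)^-1)%g.
    by apply: (mulIg (x ^+ j)%g); rewrite mulgKV -mulgA e mulKg.
  have h1 : ((y ^+ a)^-1 * y ^+ i)%g \in (<[y]> :&: <[x]>)%g.
    rewrite inE {2}h !groupM ?groupV ?mem_cycle //.
  move: h1; rewrite tI => /set1gP h1.
  have ea : a = i %[mod m].
    apply/eqP.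
    have := eq_expg_mod_order y a i; rewrite oy => <-; apply/eqP.
    by apply: (mulgI ((y ^+ a)^-1)%g); rewrite h1 mulVg.
  have eb : b = j %[mod N].
    apply/eqP; have := eq_expg_mod_order x b j; rewrite ox => <-; apply/eqP.
    apply: (mulIg ((x ^+ j)^-1)%g); by rewrite -h h1 mulgV.
  by rewrite (modX Bm ea) (modX AN eb).
have im : (i %% m < m)%N by rewrite ltn_pmod.
have jN : (j %% N < N)%N by rewrite ltn_pmod ?expn_gt0.
move/(_ (Ordinal im, Ordinal jN)) => /=.
by rewrite -oy -ox !expg_mod_order eqxx.
Qed.

Lemma D_repr_mxP : mx_repr D D_repr_mx.
Proof.
have [ox oy eD tI] := D_facts; case: hD => _ _ [xN ym rel].
have xy : (x * y = y ^+ (2 * r) * x)%g.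
  apply: (mulIg (x^-1)%g); rewrite rel mulgK; apply: (mulgI y).
  by rewrite mulgV -expgS ym.
have xyj j : (x * y ^+ j = y ^+ (2 * r * j) * x)%g.
  elim: j => [|j IH]; first by rewrite muln0 mul1g mulg1.
  by rewrite expgS mulgA xy -mulgA IH mulgA -expgD mulnS.
have xiyj i j : (x ^+ i * y ^+ j = y ^+ ((2 * r) ^ i * j) * x ^+ i)%g.
  elim: i j => [|i IH] j; first by rewrite mul1g mulg1 mul1n.
  by rewrite expgSr -mulgA xyj mulgA IH -mulgA mulnA -expnSr.
have ABj j : A * B ^+ j = B ^+ (2 * r * j) * A.
  elim: j => [|j IH]; first by rewrite muln0 mul1r mulr1.
  by rewrite exprS mulrA AB -mulrA IH mulrA -exprD mulnS.
have AiBj i j : A ^+ i * B ^+ j = B ^+ ((2 * r) ^ i * j) * A ^+ i.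
  elim: i j => [|i IH] j; first by rewrite mul1r mulr1 mul1n.
  by rewrite exprSr -mulrA ABj mulrA IH -mulrA mulnA -expnSr.
split; first by rewrite -[X in D_repr_mx X](mul1g 1%g) (D_repr_mxE 0 0) mulr1.
move=> g h; rewrite -eD => /mulsgP[_ _ /cycleP[i ->] /cycleP[j ->] ->].
case/mulsgP => _ _ /cycleP[i' ->] /cycleP[j' ->] ->.
have -> : (y ^+ i * x ^+ j * (y ^+ i' * x ^+ j') =
   y ^+ (i + (2 * r) ^ j * i') * x ^+ (j + j'))%g.
  by rewrite !mulgA -(mulgA _ (x ^+ j)%g) xiyj !mulgA -expgD -mulgA -expgD.
rewrite !D_repr_mxE mulmxE !exprD -!mulrA; congr (_ * _).
by rewrite !mulrA AiBj.
Qed.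

Lemma D_repr_of_relations : {rG : mx_representation F D n.+1 | rG x = A /\ rG y = B}.
Proof.
exists (MxRepresentation D_repr_mxP); split => /=.
  by rewrite -[x]mul1g (D_repr_mxE 0 1) mul1r.
by rewrite -[y]mulg1 (D_repr_mxE 1 0) mulr1.
Qed.
End ReprOfRelations.

Section AlphaVarrhoExist.
Variables (R : realType) (k r : nat) (k0 : (1 < k)%N) (r0 : (0 < r)%N).
Variables (gT : finGroupType) (D : {group gT}) (x y : gT).
Hypothesis hD : D_presentation k r D x y.
Let hk0 : (0 < k)%N := ltnW k0.

Lemma is_alpha_exists : exists alpha : nat -> mx_representation R[i] D 1, is_alpha k x y alpha.
Proof.
suff f j : {rG : mx_representation R[i] D 1 | rG x = (zeta R (2 ^ k) ^+ j)%:M /\ rG y = 1%:M}.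
  by exists (fun j => sval (f j)) => j; exact: (svalP (f j)).
apply: (D_repr_of_relations hk0 r0 hD).
- by rewrite -rmorphXn /= -exprM mulnC exprM zetaXn ?expn_gt0 // expr1n.
- by rewrite expr1n.
- by rewrite expr1n mulr1 mul1r.
Qed.

Lemma mx22M (a b c d a' b' c' d' : R[i]) : mx22 a b c d * mx22 a' b' c' d' =
  mx22 (a * a' + b * c') (a * b' + b * d') (c * a' + d * c') (c * b' + d * d').
Proof.
apply/matrixP => i j; rewrite !mxE big_ord_recl big_ord1 !mxE /=.
by case: i => [[|[]]] //= ?; case: j => [[|[]]] //=.
Qed.

Lemma mx22_1 (a : R[i]) : mx22 a 0 0 a = a%:M.
Proof.
apply/matrixP => i j; rewrite !mxE /=.
by case: i => [[|[]]] //= ?; case: j => [[|[]]] //=.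
Qed.

Lemma diagX (a b : R[i]) i : mx22 a 0 0 b ^+ i = mx22 (a ^+ i) 0 0 (b ^+ i).
Proof.
elim: i => [|i IH]; first by rewrite !expr0 mx22_1.
by rewrite exprS IH mx22M !mul0r !mulr0 !addr0 !add0r -!exprS.
Qed.

Lemma is_varrho_exists : exists varrho, is_varrho (R:=R) k r (D:=D) x y varrho.
Proof.
suff f t s : {rG : mx_representation R[i] D 2 |
    rG x = zeta R (2 ^ k) ^+ s *: mx22 0 1 ((-1) ^+ t) 0 /\
    rG y = mx22 (zeta R (2 * r).+1 ^+ t) 0 0 (zeta R (2 * r).+1 ^- t)}.
  by exists (fun t s => sval (f t s)) => t s; exact: (svalP (f t s)).
have z1 : zeta R (2 * r).+1 ^+ t ^+ (2 * r).+1 = 1.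
  by rewrite -exprM (mulnC t) exprM zetaXn // expr1n.
set z := zeta R (2 * r).+1 ^+ t in z1 *.
have z0 : z != 0 by apply: contra_eqN z1 => /eqP ->; rewrite expr0n eq_sym oner_neq0.
have zr : z ^+ (2 * r) = z^-1.
  by apply: (mulfI z0); rewrite mulfV // -exprS.
apply: (D_repr_of_relations hk0 r0 hD).
- rewrite exprZn -exprM (mulnC s) exprM zetaXn ?expn_gt0 // expr1n scale1r.
  rewrite -(prednK hk0) expnS exprM expr2 mx22M !mul0r !mulr0 !add0r !addr0 mul1r mulr1.
  rewrite diagX -exprM (mulnC t) exprM -(prednK (n := k.-1)) ?expnS; last by rewrite -ltnS prednK.
  by rewrite exprM sqrrN !expr1n mx22_1.
- by rewrite diagX exprVn z1 invr1 mx22_1.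
- rewrite diagX -scalerAl -scalerAr; congr (_ *: _).
  rewrite !mx22M exprVn zr invrK !mul0r !mulr0 !add0r !addr0.
  by rewrite mul1r mulr1 mulrC.
Qed.
End AlphaVarrhoExist.

(* Main.v *)
Require Import Defs.
From mathcomp Require Import all_boot all_order all_algebra.
From mathcomp Require Import all_fingroup all_solvable all_field all_character.
From mathcomp Require Import reals trigo.
From mathcomp Require Import complex.
From mathcomp Require Import ring zify.

(** Over an algebraically closed field of characteristic 0 the multiplicities of
    the irreducible constituents of a representation are determined by traces:
    the trace of the central idempotent of an irreducible constituent counts it.
    The list of irreducible representations is complete because the squares of
    their degrees sum to the order of the group. So the arrows can be read off
    identities between characters. On y^b x^a the character of varrho_{t,s}
    vanishes for odd a and otherwise equals
    (zeta_{2^k}^{2s} (-1)^t)^{a/2} (w^{tb} + w^{-tb}), with w = zeta_{2r+1}.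
    Hence, with chi_{t,s} this character, chi_{1,1} chi_{t,s} =
    chi_{t-1,s+1} + chi_{t+1,s+1}; at the two ends of the range of t one uses
    chi_{0,s} = alpha_s + alpha_{2^{k-1}+s} and the isomorphism
    varrho_{t,2^{k-2}+s} = varrho_{2r+1-t,s}. *)

Set Implicit Arguments.
Unset Strict Implicit.
Unset Printing Implicit Defensive.

Import Order.TTheory GRing.Theory Num.Theory.
Local Open Scope ring_scope.

(** * Traces, multiplicities and completeness over an algebraically closed field *)

Section TracesAndMultiplicities.
Variables (gT : finGroupType) (G : {group gT}).

(** The elements of [G] intertwined by [B] form a subgroup, so generators suffice. *)
Lemma mx_rsim_gen (F : fieldType) n (rG1 rG2 : mx_representation F G n)
    (A : {set gT}) (B : 'M[F]_n) :
    <<A>>%g = G -> B \in unitmx ->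
    {in A, forall g, rG1 g *m B = B *m rG2 g} -> mx_rsim rG1 rG2.
Proof.
move=> genA uB homA.
have grH : group_set [set g in G | rG1 g *m B == B *m rG2 g].
  apply/group_setP; split=> [|g h].
    by rewrite inE group1 !repr_mx1 mulmx1 mul1mx /=.
  rewrite !inE => /andP[Gg /eqP hg] /andP[Gh /eqP hh]; rewrite groupM //=.
  by rewrite !repr_mxM // -mulmxA hh mulmxA hg mulmxA.
have sAH : <<A>>%g \subset group grH.
  rewrite gen_subG; apply/subsetP => g Ag.
  by rewrite inE homA // eqxx andbT -genA mem_gen.
exists B; rewrite ?row_free_unit // => g Gg.
have Ag : g \in <<A>>%g by rewrite genA.
by have := subsetP sAH g Ag; rewrite inE => /andP[_ /eqP].
Qed.

Variable F : closedFieldType.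
Hypothesis F'G : ([pchar F]%R^'.-group G)%g.

(** A group ring element acts as a linear combination of group elements, so its trace depends only
    on the character of [rG]. *)
Lemma mxtrace_gring_op n (rG : mx_representation F G n) A :
  \tr (gring_op rG A) = \sum_k gring_row A 0 k * \tr (rG (enum_val k)).
Proof.
rewrite gring_opE [in LHS](row_sum_delta (gring_row A)) !linear_sum.
apply: eq_bigr => k _; rewrite /= !linearZ /=; congr (_ * \tr _).
by rewrite /gring_mx /= -rowE rowK mxvecK.
Qed.

Lemma eq_mxtrace_gring_op n1 n2 (rG1 : mx_representation F G n1)
    (rG2 : mx_representation F G n2) A :
    {in G, forall g, \tr (rG1 g) = \tr (rG2 g)} ->
  \tr (gring_op rG1 A) = \tr (gring_op rG2 A).
Proof.
move=> eq12; rewrite !mxtrace_gring_op.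
by apply: eq_bigr => k _; rewrite eq12 ?enum_valP.
Qed.

(** The central idempotent of type [i] acts as the identity on an irreducible of type [i] and as
    zero on any other; it serves below to count constituents. *)
Lemma mxtrace_Wedderburn_id (sG : irrType F G) n (rG : mx_representation F G n)
    (i : sG) :
    mx_irreducible rG ->
  \tr (gring_op rG (Wedderburn_id i)) = n%:R *+ (i == irr_comp sG rG).
Proof.
move=> irrG; have rsimG := rsim_irr_comp_pchar sG F'G irrG.
rewrite (eq_mxtrace_gring_op _ (mxtrace_rsim rsimG)).
have [-> | ne_i] := eqVneq i (irr_comp sG rG).
  by rewrite op_Wedderburn_id_pchar // mxtrace1 -(mxrank_rsim rsimG).
rewrite (irr_comp'_op0_pchar F'G (socle_irr _) _ (Wedderburn_id_mem i)).
  by rewrite mxtrace0.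
by rewrite (irr_reprK_pchar F'G).
Qed.

Lemma mxtrace_dadd (rG1 rG2 : representation F G) g :
  \tr (dadd_grepr rG1 rG2 g) = \tr (rG1 g) + \tr (rG2 g).
Proof. exact: mxtrace_block. Qed.

Lemma mxtrace_dsum (J : Type) (s : seq J) (P : pred J)
    (rG : J -> representation F G) g :
  \tr ((\big[dadd_grepr/grepr0]_(j <- s | P j) rG j) g)
    = \sum_(j <- s | P j) \tr (rG j g).
Proof.
apply: (big_morph (fun rW : representation F G => \tr (rW g))) => [rW1 rW2|].
  exact: mxtrace_dadd.
by rewrite mxtrace1.
Qed.

Lemma mxtrace_muln (rG : representation F G) m g :
  \tr (muln_grepr rG m g) = \tr (rG g) *+ m.
Proof. by rewrite mxtrace_dsum sumr_const card_ord. Qed.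

Variables (I : finType) (irreps : I -> representation F G).

Lemma irr_comp_inj (sG : irrType F G) :
    (forall i, mx_irreducible (irreps i)) ->
    (forall i j, mx_rsim (irreps i) (irreps j) -> i = j) ->
  injective (fun i => irr_comp sG (irreps i)).
Proof.
move=> irr_i ne_ij i j eq_ij; apply: ne_ij.
apply: mx_rsim_trans (rsim_irr_comp_pchar sG F'G (irr_i i)) _; rewrite eq_ij.
exact/mx_rsim_sym/rsim_irr_comp_pchar.
Qed.

(** The squared degrees of all irreducible types, read off the regular representation, sum to
    [#|G|]. The listed types already reach this sum, so an unlisted one would have degree 0. *)
Lemma complete_irreps_of_sum_squares :
    (forall i, mx_irreducible (irreps i)) ->
    (forall i j, mx_rsim (irreps i) (irreps j) -> i = j) ->
    (\sum_i rdegree (irreps i) ^ 2 = #|G|)%N ->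
  complete_irreps irreps.
Proof.
move=> irr_i ne_ij sum2; split=> // n rG irrG.
pose sG : irrType F G := DecSocleType _.
pose h i := irr_comp sG (irreps i).
have injh : injective h by apply: irr_comp_inj.
have dimh i : irr_degree (h i) = rdegree (irreps i).
  by rewrite -(mxrank_rsim (rsim_irr_comp_pchar sG F'G (irr_i i))).
have := sum_irr_degree_pchar sG F'G (@group_closure_closed_field F gT G).
rewrite (bigID (mem [set h i | i in I])) /= -[RHS]addn0 -sum2.
have -> : (\sum_(W in [set h i | i in I]) irr_degree W ^ 2
           = \sum_i rdegree (irreps i) ^ 2)%N.
  rewrite big_imset /= => [|i j _ _ /injh //].
  by apply: eq_bigr => i _; rewrite dimh.
move/eqP; rewrite eqn_add2l sum_nat_eq0 => /forall_inP no_other.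
have /imsetP[i _ def_i] : irr_comp sG rG \in [set h i | i in I].
  apply: contraT => /no_other; rewrite expn_eq0 andbT => /eqP.
  by move: (irr_degree_gt0 (irr_comp sG rG)) => /[swap] ->.
exists i; apply: mx_rsim_trans (rsim_irr_comp_pchar sG F'G irrG) _.
rewrite def_i; exact/mx_rsim_sym/rsim_irr_comp_pchar.
Qed.

Hypothesis cpl : complete_irreps irreps.

(** On the direct sum with multiplicities [c], the idempotent of [irreps i] has trace [c i] times
    the degree of [irreps i]. *)
Lemma multiplicities_of_traces (a b : I -> nat) :
    [pchar F] =i pred0 ->
    {in G, forall g, \sum_j \tr (irreps j g) *+ a j
                     = \sum_j \tr (irreps j g) *+ b j} ->
  a =1 b.
Proof.
move=> charF0 eq_ab i; have [irr_i ne_ij _] := cpl.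
pose sG : irrType F G := DecSocleType _.
pose S c : representation F G :=
  \big[dadd_grepr/grepr0]_j muln_grepr (irreps j) (c j).
have trS c g : \tr (S c g) = \sum_j \tr (irreps j g) *+ c j.
  by rewrite mxtrace_dsum; apply: eq_bigr => j _; rewrite mxtrace_muln.
pose e := Wedderburn_id (irr_comp sG (irreps i)).
have tr_e c : \tr (gring_op (S c) e) = (rdegree (irreps i))%:R *+ c i.
  transitivity (\sum_j \tr (gring_op (irreps j) e) *+ c j); last first.
    rewrite (bigD1 i) //= mxtrace_Wedderburn_id // eqxx mulr1n.
    rewrite big1 ?addr0 // => j ne_ji.
    rewrite mxtrace_Wedderburn_id // (inj_eq (irr_comp_inj irr_i ne_ij)).
    by rewrite eq_sym (negPf ne_ji) mulr0n mul0rn.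
  rewrite mxtrace_gring_op; under eq_bigr do rewrite trS mulr_sumr.
  rewrite exchange_big /=; apply: eq_bigr => j _.
  rewrite mxtrace_gring_op -sumrMnl.
  by apply: eq_bigr => k _; rewrite mulrnAr.
have := tr_e a; rewrite (@eq_mxtrace_gring_op _ _ _ (S b)) ?tr_e; last first.
  by move=> g Gg; rewrite !trS eq_ab.
have d_gt0 : (0 < rdegree (irreps i))%N by case/mx_irrP: (irr_i i).
move/eqP; rewrite -!mulrnA.
(* In characteristic 0 the equality of traces descends to [nat], where the positive degree
   cancels. *)
have natr_inj (m n : nat) : m%:R = n%:R :> F -> m = n.
  wlog le_mn : m n / (m <= n)%N.
    by move=> W; case/orP: (leq_total m n) => /W // h /esym/h.
  move=> e_mn; apply/eqP; rewrite eqn_leq le_mn -subn_eq0.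
  by rewrite -((pcharf0P F).1 charF0) natrB // e_mn subrr eqxx.
by move=> /eqP/natr_inj/eqP; rewrite eqn_pmul2l // => /eqP.
Qed.

(** By Maschke the module is its own socle, hence the direct sum of its isotypic components; these
    are reindexed by [I]. *)
Lemma complete_irreps_decomposition n (rG : mx_representation F G n) :
  exists c : I -> nat,
    mx_rsim rG (\big[dadd_grepr/grepr0]_j muln_grepr (irreps j) (c j)).
Proof.
have [irr_i ne_ij complete] := cpl.
pose sG := DecSocleType rG.
have /fin_all_exists[w rsim_w] (W : sG) :
    exists i, mx_rsim (socle_repr W) (irreps i).
  exact/complete/socle_irr.
have injw : injective w.
  move=> W1 W2 eq_w; apply/eqP/socle_rsimP; apply: mx_rsim_trans (rsim_w W1) _.
  by rewrite eq_w; apply: mx_rsim_sym.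
(* By [injw] this sum has at most one term: [U i] is the component of type [i], or zero if that type
   does not occur. *)
have [U defU] : exists U : I -> 'M_n,
    forall i, U i = (\sum_(W : sG | w W == i) W)%MS.
  by exists (fun i => \sum_(W : sG | w W == i) W)%MS.
have modU i : mxmodule rG (U i).
  by rewrite defU; apply: sumsmx_module => W _; apply: component_mx_module.
have sumU : (\sum_i U i)%MS = Socle sG.
  by rewrite /Socle (partition_big w xpredT) //=; apply: eq_bigr.
have soc1 : (Socle sG :=: 1%:M)%MS.
  by rewrite (reducible_Socle1 sG (mx_Maschke_pchar rG F'G)).
have dxU : mxdirect (\sum_i U i).
  apply/eqP; rewrite /= sumU.
  rewrite (mxdirectP (Socle_direct sG)) /= (partition_big w xpredT) //=.
  apply: eq_bigr => i _; rewrite defU.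
  have [W /eqP <- | no_W] := pickP (fun W => w W == i).
    by rewrite !(big_pred1 W) // => W'; rewrite /= (inj_eq injw).
  by rewrite !big_pred0 ?mxrank0.
have /fin_all_exists[c rsim_c] i :
    exists c, mx_rsim (submod_repr (modU i)) (muln_grepr (irreps i) c).
  have [W /eqP def_i | no_W] := pickP (fun W => w W == i).
    exists (socle_mult W); move: (modU i).
    have -> : U i = W.
      by rewrite defU (big_pred1 W) // => W'; rewrite /= -def_i (inj_eq injw).
    move=> modW; rewrite -def_i.
    apply: mx_rsim_trans (mx_rsim_socle (rsim_w W)).
    exact/mx_rsim_iso/mx_iso_refl.
  (* The type [i] does not occur: multiplicity 0, with the empty matrix intertwining two modules of
     degree 0. *)
  exists 0%N; rewrite /muln_grepr big_ord0.
  have U0 : U i = 0 by rewrite defU big_pred0.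
  by exists 0 => [||g _]; rewrite /row_free ?U0 ?mxrank0 ?mulmx0 ?mul0mx.
exists c.
apply: mx_rsim_trans (mx_rsim_sym (rsim_submod1 (mxmodule1 rG) _)) _ => //.
apply: (mx_rsim_dsum (modU := modU)) dxU rsim_c.
by rewrite sumU.
Qed.

Lemma mckay_quiver_exists n (rho : mx_representation F G n) :
  exists a, mckay_quiver irreps rho a.
Proof.
by apply: (@fin_all_exists _ _ (fun i c => mx_rsim (prod_repr rho (irreps i))
  (\big[dadd_grepr/grepr0]_j muln_grepr (irreps j) (c j)))) => i;
  apply: complete_irreps_decomposition.
Qed.

(** The form in which arrows are computed: a character identity whose right side lists the targets,
    with repetition, becomes a count of occurrences. *)
Lemma mckay_quiver_of_traces n (rho : mx_representation F G n) a i
    (ts : seq I) :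
    [pchar F] =i pred0 -> mckay_quiver irreps rho a ->
    {in G, forall g, \tr (rho g) * \tr (irreps i g)
                     = \sum_(j <- ts) \tr (irreps j g)} ->
  forall j, a i j = count_mem j ts.
Proof.
move=> charF0 quiv_a tr_ts; apply: multiplicities_of_traces => // g Gg.
have := mxtrace_rsim (quiv_a i) Gg; rewrite mxtrace_prod tr_ts // mxtrace_dsum.
rewrite (eq_bigr _ (fun j _ => mxtrace_muln (irreps j) (a i j) g)) => <-.
elim: ts {tr_ts} => [|k ts IHts]; first by rewrite big_nil big1.
rewrite big_cons {}IHts /=; under [RHS]eq_bigr do rewrite mulrnDr.
rewrite big_split /=; congr (_ + _); rewrite (bigD1 k) //= eqxx mulr1n.
rewrite big1 ?addr0 // => j ne_jk.
by rewrite eq_sym (negPf ne_jk).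
Qed.

End TracesAndMultiplicities.

(** * Roots of unity and matrices of size two *)

Lemma pchar'_group (F : numDomainType) (gT : finGroupType) (G : {group gT}) :
  ([pchar F]%R^'.-group G)%g.
Proof. by apply/pgroupP=> p _; rewrite inE /= pchar_num. Qed.

(** If the order [m] were less than [n], then [theta = pi * m / n] would lie strictly between 0 and
    [pi] while [cos (2 * theta) = 1], forcing [sin theta = 0]. *)
Lemma zeta_prim (R : realType) n : (0 < n)%N -> n.-primitive_root (zeta R n).
Proof.
move=> n_gt0; have [m prim_m dvd_mn] := prim_order_exists n_gt0 (zetaXn R n_gt0).
have m_gt0 := prim_order_gt0 prim_m.
have := dvdn_leq n_gt0 dvd_mn; rewrite leq_eqVlt.
case/predU1P=> [eq_mn | lt_mn]; first by rewrite -{1}eq_mn.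
pose theta : R := pi * (m%:R / n%:R).
have n0 : 0 < n%:R :> R by rewrite ltr0n.
have sin_gt0 : 0 < sin theta.
  rewrite /theta; apply: sin_gt0_pi; apply/andP; split.
    by rewrite mulr_gt0 ?pi_gt0 // divr_gt0 // ltr0n.
  by rewrite gtr_pMr ?pi_gt0 // ltr_pdivrMr // mul1r ltr_nat.
have := prim_expr_order prim_m; rewrite zetaX => -[cos1 _].
have : sin theta ^+ 2 = 0.
  have e : 2 * pi / n%:R *+ m = theta *+ 2.
    by rewrite /theta -mulr_natr -[RHS]mulr_natr; ring.
  move: cos1; rewrite e cos_mulr2n sin2cos2 => c1.
  have c2 : cos theta ^+ 2 *+ 2 = 1 *+ 2 by rewrite -[LHS](subrK 1) c1.
  by rewrite (pmulrnI (ltn0Sn 1) c2) subrr.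
by move/eqP; rewrite expf_eq0 /= gt_eqF.
Qed.

Lemma mxtrace_mx22 (R : realType) (a b c d : R[i]) : \tr (mx22 a b c d) = a + d.
Proof. by rewrite /mxtrace big_ord_recl big_ord1 !mxE. Qed.

Lemma mx22_scale (R : realType) (z a b c d : R[i]) :
  z *: mx22 a b c d = mx22 (z * a) (z * b) (z * c) (z * d).
Proof.
apply/matrixP => i j; rewrite !mxE.
by case: ifP => _; case: ifP.
Qed.

Lemma eq_rV2 (T : Type) (u v : 'rV[T]_2) :
  u 0 0 = v 0 0 -> u 0 1 = v 0 1 -> u = v.
Proof.
move=> e0 e1; apply/rowP => -[[|[]]] //= lti.
  by have -> : Ordinal lti = 0 by apply: val_inj.
by have -> : Ordinal lti = 1 by apply: val_inj.
Qed.

Lemma mul_rV_mx22 (R : realType) (v : 'rV[R[i]]_2) a b c d :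
  ((v *m mx22 a b c d) 0 0 = v 0 0 * a + v 0 1 * c) *
  ((v *m mx22 a b c d) 0 1 = v 0 0 * b + v 0 1 * d).
Proof.
by split; rewrite mxE big_ord_recl big_ord1 !mxE /=;
  congr (v _ _ * _ + v _ _ * _); apply: val_inj.
Qed.

(** The square of an antidiagonal matrix is scalar, equal to the product of its two entries. *)
Lemma antidiagX_even (R : realType) (z e : R[i]) n :
  (z *: mx22 0 1 e 0) ^+ n.*2 = mx22 ((z ^+ 2 * e) ^+ n) 0 0 ((z ^+ 2 * e) ^+ n).
Proof.
rewrite -mul2n exprM expr2 mx22_scale mx22M -diagX; congr (_ ^+ n).
by congr mx22; ring.
Qed.

Lemma expr2n_eqN1 (F : idomainType) n (z : F) :
  (0 < n)%N -> (n.*2).-primitive_root z -> z ^+ n = -1.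
Proof.
move=> n_gt0 prim_z; have := prim_expr_order prim_z.
rewrite -muln2 exprM => /eqP; rewrite sqrf_eq1 => /predU1P[z1 | /eqP //].
have : (n.*2 %| n)%N by rewrite (prim_order_dvd prim_z) z1 eqxx.
by move=> /(dvdn_leq n_gt0); rewrite -addnn -{3}[n]addn0 leq_add2l leqNgt n_gt0.
Qed.

(** * The group [D] and the characters of its representations *)

Section IrreducibleRepresentations.
Variables (R : realType) (k r : nat) (hk : (2 < k)%N) (hr : (0 < r)%N).
Variables (gT : finGroupType) (D : {group gT}) (x y : gT).
Hypothesis hD : D_presentation k r D x y.
Variable alpha : nat -> mx_representation R[i] D 1.
Hypothesis halpha : is_alpha k x y alpha.
Variable varrho : nat -> nat -> mx_representation R[i] D 2.
Hypothesis hvarrho : is_varrho k r x y varrho.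

Let q := (2 ^ (k - 2))%N.
Let m := (2 * r).+1.
Local Notation z := (zeta R (2 ^ k)).
Local Notation w := (zeta R m).

Let k_gt0 : (0 < k)%N. Proof. exact: leq_trans hk. Qed.

Lemma expn2_4q : (2 ^ k = 4 * q)%N.
Proof. by rewrite /q -(expnD 2 2) subnKC // ltnW. Qed.

Lemma expn2_2q : (2 ^ (k - 1) = 2 * q)%N.
Proof. by rewrite /q -expnS -subSn ?(ltnW hk). Qed.

Lemma q_gt1 : (1 < q)%N.
Proof. by rewrite /q -{1}(expn0 2) ltn_exp2l // subn_gt0. Qed.

Lemma card_D : #|D| = (2 ^ k * m)%N.
Proof.
have [ox oy eD tI] := D_facts k_gt0 hr hD.
by rewrite -eD TI_cardMg // -!orderE ox oy mulnC.
Qed.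

Lemma xD : x \in D.
Proof. by case: hD => _ <- _; rewrite mem_gen // !inE eqxx. Qed.

Lemma yD : y \in D.
Proof. by case: hD => _ <- _; rewrite mem_gen // !inE eqxx orbT. Qed.

Lemma D_elementP g : g \in D -> exists a b, g = (y ^+ b * x ^+ a)%g.
Proof.
have [_ _ <- _] := D_facts k_gt0 hr hD.
by case/mulsgP => _ _ /cycleP[b ->] /cycleP[a ->] ->; exists a, b.
Qed.

Lemma z_prim : (2 ^ k).-primitive_root z.
Proof. by apply: zeta_prim; rewrite expn_gt0. Qed.

Lemma w_prim : m.-primitive_root w.
Proof. exact: zeta_prim. Qed.

Lemma z2q : z ^+ (2 * q) = -1.
Proof.
apply: expr2n_eqN1; first by rewrite muln_gt0 (ltnW q_gt1).
by rewrite -mul2n mulnA -expn2_4q z_prim.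
Qed.

Lemma w_neq0 : w != 0.
Proof. by rewrite (prim_root_eq0 w_prim). Qed.

Lemma mxtrace_alpha j a b : \tr (alpha j (y ^+ b * x ^+ a)%g) = z ^+ (j * a).
Proof.
have [ax ay] := halpha j.
rewrite repr_mxM ?groupX ?xD ?yD // !repr_mxX ?xD ?yD // ax ay.
by rewrite expr1n mul1mx -rmorphXn /= mxtrace_scalar mulr1n exprM.
Qed.

Lemma mxtrace_varrho t s a b :
  \tr (varrho t s (y ^+ b * x ^+ a)%g) =
    if odd a then 0
    else (z ^+ (2 * s) * (-1) ^+ t) ^+ a./2 * (w ^+ (t * b) + w ^- (t * b)).
Proof.
have [rx ry] := hvarrho t s.
rewrite repr_mxM ?groupX ?xD ?yD // !repr_mxX ?xD ?yD // rx ry mulmxE diagX.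
rewrite -[a in LHS]odd_double_half; case: (odd a).
  by rewrite exprS antidiagX_even mx22_scale !mx22M mxtrace_mx22; ring.
rewrite add0n antidiagX_even mx22M mxtrace_mx22 -[z ^+ s ^+ 2]exprM.
by rewrite [(s * 2)%N]mulnC exprVn (exprM w) -/m; ring.
Qed.

Lemma mxtrace_alpha_varrho i : {in D, forall g,
  \tr (varrho 1 1 g) * \tr (alpha i g) = \tr (varrho 1 i.+1 g)}.
Proof.
move=> _ /D_elementP[a [b ->]]; rewrite mxtrace_alpha !mxtrace_varrho.
case: ifPn => [_ | even_a]; first by rewrite mul0r.
have -> : (i * a = 2 * i * a./2)%N.
  by rewrite -{1}(even_halfK even_a) -muln2 mulnC -mulnA mulnC.
by rewrite (mulnS 2 i) exprD (exprM z (2 * i)%N) muln1 !exprMn; ring.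
Qed.

(** With [u = w ^+ b], this expands [(u + u^-1) * (u ^+ t.+1 + u ^- t.+1)]. Starting at [t.+1] lets
    [t = 0] produce [varrho 0 s.+1], whose character is a sum of two linear ones. *)
Lemma mxtrace_varrho_varrho t s : {in D, forall g,
  \tr (varrho 1 1 g) * \tr (varrho t.+1 s g) =
  \tr (varrho t s.+1 g) + \tr (varrho t.+2 s.+1 g)}.
Proof.
move=> _ /D_elementP[a [b ->]]; rewrite !mxtrace_varrho.
case: ifP => _; first by rewrite mul0r addr0.
have wS n : w ^+ (n.+1 * b) = w ^+ b * w ^+ (n * b) by rewrite mulSn exprD.
have sgnS n : (-1) ^+ n.+1 = - (-1) ^+ n :> R[i] by rewrite exprS mulN1r.
rewrite mulrACA -exprMn !wS !mul0n !sgnS opprK muln1 (mulnS 2 s) exprD.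
set P := _ ^+ a./2; set Q := _ ^+ a./2.
(* The scalars agree: the powers of [z] add up to [2 * s + 2], and the signs of the two factors
   multiply to [(-1) ^+ t]. *)
have -> : P = Q by congr (_ ^+ _); ring.
have u0 : w ^+ b != 0 by rewrite expf_neq0 ?w_neq0.
have v0 : w ^+ (t * b) != 0 by rewrite expf_neq0 ?w_neq0.
by field; rewrite v0.
Qed.

(** Since [z ^+ (2 * q) = -1], the two linear characters cancel for odd [a] and coincide for even
    [a]. *)
Lemma mxtrace_varrho0 s : {in D, forall g,
  \tr (varrho 0 s g) = \tr (alpha s g) + \tr (alpha (2 * q + s) g)}.
Proof.
move=> _ /D_elementP[a [b ->]]; rewrite !mxtrace_alpha mxtrace_varrho.
rewrite mul0n !expr0 invr1 !mulr1 mulnDl exprD (exprM z (2 * q)%N) z2q -signr_odd.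
case: ifPn => [_ | even_a]; first by rewrite expr1 mulN1r subrr.
have -> : (s * a = 2 * s * a./2)%N.
  by rewrite -{1}(even_halfK even_a) -muln2 mulnC -mulnA mulnC.
by rewrite (exprM z (2 * s)%N) expr0 mul1r mulrDr mulr1.
Qed.

Lemma mxtrace_alpha_mod j : {in D, forall g,
  \tr (alpha (j %% 2 ^ k) g) = \tr (alpha j g)}.
Proof.
move=> _ /D_elementP[a [b ->]]; rewrite !mxtrace_alpha !exprM.
by rewrite (prim_expr_mod z_prim).
Qed.

Lemma sgn_reflect t : (t <= m)%N -> (-1) ^+ (m - t) = - (-1) ^+ t :> R[i].
Proof.
move=> le_tm; apply: (mulIf (x := (-1) ^+ t)); first by rewrite signr_eq0.
rewrite -exprD subnK // mulNr -expr2 sqrr_sign.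
by rewrite exprS exprM sqrrN !expr1n mulr1.
Qed.

(** The intertwiner must swap the coordinate lines, as [w ^+ (m - t) = w ^- t]; compatibility with
    [x] then fixes its lower entry [c]. Its two conditions on [c] agree because [m] is odd and
    [z ^+ (2 * q) = -1]. *)
Lemma varrho_reflect t s : (t <= m)%N ->
  mx_rsim (varrho t (q + s)) (varrho (m - t) s).
Proof.
move=> le_tm; pose c := z ^+ q * (-1) ^+ t.
have zq2 : z ^+ q * z ^+ q = -1 by rewrite -exprD addnn -mul2n z2q.
have sgn2 : (-1) ^+ t * (-1) ^+ t = 1 :> R[i] by rewrite -expr2 sqrr_sign.
have sgn := sgn_reflect le_tm.
have wr : w ^+ (m - t) = w ^- t.
  apply: (mulIf (expf_neq0 t w_neq0)); rewrite -exprD subnK //.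
  by rewrite (prim_expr_order w_prim) mulVf ?expf_neq0 ?w_neq0.
have cV : c * (- c) = 1.
  transitivity (- (z ^+ q * z ^+ q) * ((-1) ^+ t * (-1) ^+ t)).
    by rewrite /c; ring.
  by rewrite zq2 sgn2 opprK mulr1.
have [_ genD _] := hD.
apply: (@mx_rsim_gen _ _ _ _ _ _ [set x; y] (mx22 0 1 c 0)) => // [|g].
  have : mx22 0 1 c 0 *m mx22 0 (- c) 1 0 = 1%:M.
    rewrite mulmxE mx22M -mx22_1.
    by congr mx22; rewrite ?mulr0 ?mul0r ?addr0 ?add0r ?mulr1.
  by move=> /mulmx1_unit[].
have [[tx ty] [mx my]] := (hvarrho t (q + s)%N, hvarrho (m - t)%N s).
rewrite !inE => /orP[] /eqP ->.
  rewrite tx mx !mulmxE !mx22_scale !mx22M sgn exprD.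
  congr mx22; rewrite /c; try ring.
  by transitivity (z ^+ q * z ^+ q * (z ^+ s * (-1) ^+ t)); [|rewrite zq2]; ring.
rewrite ty my !mulmxE !mx22M wr invrK.
by congr mx22; ring.
Qed.

(** * Irreducibility, pairwise non-isomorphism and completeness *)

Lemma alpha_irreducible j : mx_irreducible (alpha j).
Proof.
apply/mx_irrP; split=> // U _; rewrite -mxrank_eq0 -lt0n => rankU.
by rewrite /row_full eqn_leq rank_leq_row rankU.
Qed.

(** With [X = w ^+ t] and [Y = w ^+ u], the difference of the two sides times [X * Y] factors as
    [(X - Y) * (X * Y - 1)]; and [t + u] lies strictly between 0 and [2 * m]. *)
Lemma w_expr_eq t u : (0 < t < m)%N -> (0 < u < m)%N ->
  w ^+ t + w ^- t = w ^+ u + w ^- u -> t = u \/ (t + u = m)%N.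
Proof.
move=> /andP[t_gt0 lt_tm] /andP[u_gt0 lt_um] eq_tu.
have t0 := expf_neq0 t w_neq0; have u0 := expf_neq0 u w_neq0.
have : (w ^+ t - w ^+ u) * (w ^+ (t + u) - 1) == 0.
  have -> : (w ^+ t - w ^+ u) * (w ^+ (t + u) - 1) = w ^+ t * w ^+ u *
      ((w ^+ t + w ^- t) - (w ^+ u + w ^- u)).
    by rewrite exprD; field; rewrite t0 u0.
  by rewrite eq_tu subrr mulr0.
rewrite mulf_eq0 !subr_eq0 => /orP[|].
  rewrite (eq_prim_root_expr w_prim) !modn_small // => /eqP; by left.
rewrite -(prim_order_dvd w_prim) => /dvdnP[[|[|c]] def_tu];
  right; move: def_tu; lia.
Qed.

(** As [y] is diagonal with distinct eigenvalues, a nonzero submodule contains a basis vector; [x]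
    swaps the two basis lines. *)
Lemma varrho_irreducible t s : (0 < t <= 2 * r)%N -> mx_irreducible (varrho t s).
Proof.
move=> /andP[t_gt0 le_t2r]; apply/mx_irrP; split=> // U modU.
have [rx ry] := hvarrho t s.
pose e i : 'rV[R[i]]_2 := delta_mx 0 i.
have sub_row (v : 'rV_2) g :
    g \in D -> (v <= U)%MS -> (v *m varrho t s g <= U)%MS.
  by move=> Dg vU; apply: mxmodule_trans vU.
have z0 : z ^+ s != 0 by rewrite expf_neq0 // (prim_root_eq0 z_prim) expn_eq0.
have e01 : (e 0 <= U)%MS -> (e 1 <= U)%MS.
  move=> /(sub_row _ _ xD); rewrite rx mx22_scale.
  have -> : e 0 *m mx22 (z ^+ s * 0) (z ^+ s * 1) (z ^+ s * (-1) ^+ t) (z ^+ s * 0)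
      = z ^+ s *: e 1.
    by apply: eq_rV2; rewrite mul_rV_mx22 !mxE /=; ring.
  by rewrite eqmx_scale.
have e10 : (e 1 <= U)%MS -> (e 0 <= U)%MS.
  move=> /(sub_row _ _ xD); rewrite rx mx22_scale.
  have -> : e 1 *m mx22 (z ^+ s * 0) (z ^+ s * 1) (z ^+ s * (-1) ^+ t) (z ^+ s * 0)
      = (z ^+ s * (-1) ^+ t) *: e 0.
    by apply: eq_rV2; rewrite mul_rV_mx22 !mxE /=; ring.
  by rewrite eqmx_scale // mulf_neq0 // signr_eq0.
(* Otherwise [m] divides [2 * t], which lies strictly between 0 and [2 * m]; so [2 * t = m], but [m]
   is odd. *)
have w_neqV : w ^+ t - w ^- t != 0.
  rewrite subr_eq0; apply/eqP => eq_w.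
  have : w ^+ (t + t) = 1 by rewrite exprD {1}eq_w mulVf // expf_neq0 ?w_neq0.
  move=> /eqP; rewrite -(prim_order_dvd w_prim) => /dvdnP[[|[|c]]]; lia.
case/rowV0Pn => v vU nz_v.
(* Taking for [c] one eigenvalue of [y] kills the corresponding coordinate of [v] and isolates the
   other. *)
have vYU c : (v *m varrho t s y - c *: v <= U)%MS.
  by rewrite addmx_sub ?eqmx_opp ?scalemx_sub ?sub_row ?yD.
have v0U : v 0 0 != 0 -> (e 0 <= U)%MS.
  move=> nz0; have := vYU (w ^- t); rewrite ry.
  have -> : v *m mx22 (w ^+ t) 0 0 (w ^- t) - w ^- t *: v
      = (v 0 0 * (w ^+ t - w ^- t)) *: e 0.
    by apply: eq_rV2; rewrite [LHS]mxE mul_rV_mx22 !mxE /=; ring.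
  by rewrite eqmx_scale // mulf_neq0.
have v1U : v 0 1 != 0 -> (e 1 <= U)%MS.
  move=> nz1; have := vYU (w ^+ t); rewrite ry.
  have -> : v *m mx22 (w ^+ t) 0 0 (w ^- t) - w ^+ t *: v
      = (v 0 1 * (w ^- t - w ^+ t)) *: e 1.
    by apply: eq_rV2; rewrite [LHS]mxE mul_rV_mx22 !mxE /=; ring.
  by rewrite eqmx_scale // mulf_neq0 // -opprB oppr_eq0.
have [e0U e1U] : (e 0 <= U)%MS /\ (e 1 <= U)%MS.
  have [v00 | /v0U e0U] := eqVneq (v 0 0) 0; last by split; last exact: e01.
  have [v01 | /v1U e1U] := eqVneq (v 0 1) 0; last by split; first exact: e10.
  by case/eqP: nz_v; apply: eq_rV2; rewrite ?v00 ?v01 mxE.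
rewrite -sub1mx; apply/row_subP => i; rewrite row1 -/(e i).
by case: i => -[|[]].
Qed.

Let irreps := @vertex_irrep R[i] gT D k r alpha varrho.

Lemma vertex_irrep_irreducible v : mx_irreducible (irreps v).
Proof.
case: v => [i | [t s]] /=; first exact: alpha_irreducible.
by apply: varrho_irreducible; rewrite ltn_ord.
Qed.

(** The trace at [x] separates the [alpha], and the degree separates them from the [varrho]. For the
    latter, the trace at [y] gives [t] up to reflection, and the trace at [x ^+ 2] settles the
    rest. *)
Lemma vertex_irrep_rsim_inj v v' : mx_rsim (irreps v) (irreps v') -> v = v'.
Proof.
case: v v' => [i | [t s]] [j | [u s']] rsim_vv'.
- have := mxtrace_rsim rsim_vv' xD; rewrite /= -[x]mul1g -[x]expg1 -(expg0 y).
  rewrite !mxtrace_alpha !muln1 => /eqP.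
  rewrite (eq_prim_root_expr z_prim) !modn_small // => /eqP eq_ij.
  by congr inl; apply: val_inj.
- by have := mxrank_rsim rsim_vv'.
- by have := mxrank_rsim rsim_vv'.
have tr_eq a b : \tr (varrho t.+1 s (y ^+ b * x ^+ a)%g)
               = \tr (varrho u.+1 s' (y ^+ b * x ^+ a)%g).
  by apply: (mxtrace_rsim rsim_vv'); rewrite groupM ?groupX ?xD ?yD.
have tr_y := tr_eq 0 1; have tr_x2 := tr_eq 2 0.
rewrite !mxtrace_varrho /= !expr0 !mul1r !muln1 in tr_y.
rewrite !mxtrace_varrho /= !muln0 !expr0 !invr1 !expr1 in tr_x2.
have two_neq0 : 1 + 1 != 0 :> R[i] by rewrite (_ : 1 + 1 = 2%:R) // pnatr_eq0.
move/(mulIf two_neq0): tr_x2 => {two_neq0} tr_x2.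
have sgn_neq0 : (-1) ^+ t.+1 != 0 :> R[i] by rewrite signr_eq0.
have lt_2v (v : 'I_(2 ^ (k - 2))) : (2 * v < 2 * q)%N.
  by rewrite ltn_pmul2l // ltn_ord.
have [lt_s lt_s'] := (lt_2v s, lt_2v s').
have [eq_tu | sum_tu] : t.+1 = u.+1 \/ (t.+1 + u.+1 = m)%N.
- by apply: w_expr_eq tr_y; rewrite /m /= ltnS.
- move: tr_x2; rewrite -eq_tu => /(mulIf sgn_neq0)/eqP.
  rewrite (eq_prim_root_expr z_prim) !modn_small; try by rewrite expn2_4q; lia.
  rewrite eqn_pmul2l // => /eqP eq_ss'.
  by congr (inr (_, _)); apply: val_inj => //; case: eq_tu.
(* Reflecting flips the sign, so [2 * s] would equal [2 * q + 2 * s'] modulo [4 * q], impossible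
   since [s] and [s'] are below [q]. *)
have def_u : u.+1 = (m - t.+1)%N by rewrite -sum_tu addKn.
move: tr_x2; rewrite def_u sgn_reflect -?sum_tu ?leq_addr //.
rewrite mulrN -mulNr => /(mulIf sgn_neq0)/eqP; rewrite -mulN1r -z2q -exprD.
rewrite (eq_prim_root_expr z_prim) !modn_small; try by rewrite expn2_4q; lia.
by move/eqP; lia.
Qed.

(** The squares of the degrees give [4 * q + 4 * (2 * r * q) = 4 * q * m], the order of [D]. *)
Lemma vertex_irrep_complete : complete_irreps irreps.
Proof.
apply: (complete_irreps_of_sum_squares (pchar'_group _ _)).
- exact: vertex_irrep_irreducible.
- exact: vertex_irrep_rsim_inj.
rewrite big_sumType /= card_D.
rewrite (eq_bigr (fun=> 1%N)) // [X in (_ + X)%N](eq_bigr (fun=> 4%N)) => [|[] //].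
rewrite !sum_nat_const card_prod !card_ord expn2_4q -/q /m; lia.
Qed.

(** * From character identities to arrows between labels *)

Definition label_mxtrace (l : label) (g : gT) : R[i] :=
  match l with
  | inl i => \tr (alpha i g)
  | inr (t, s) => \tr (varrho t s g)
  end.

Definition label_ok (l : label) : bool :=
  match l with
  | inl i => (i < 2 ^ k)%N
  | inr (t, s) => [&& 0 < t, t <= 2 * r & s < q]%N
  end.

Lemma label_okP l : label_ok l -> exists v : vertex k r, vertex_label v = l.
Proof.
case: l => [i lti | [[|t] s] /and3P[//= _ lt_t2r lt_sq]].
  by exists (inl (Ordinal lti)).
by exists (inr (Ordinal lt_t2r, Ordinal lt_sq)).
Qed.

Lemma vertex_label_inj : injective (@vertex_label k r).
Proof.
move=> [i | [t s]] [j | [u s']] //=.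
  by case=> eq_ij; congr inl; apply: val_inj.
by case=> eq_tu eq_ss'; congr (inr (_, _)); apply: val_inj.
Qed.

(** Targets in range lift to vertices, and [vertex_label_inj] makes counting labels the same as
    counting vertices. *)
Lemma arrows_from_of_traces a src targets :
    mckay_quiver irreps (varrho 1 1) a -> all label_ok targets ->
    {in D, forall g, \tr (varrho 1 1 g) * label_mxtrace src g
                     = \sum_(l <- targets) label_mxtrace l g} ->
  arrows_from a src targets.
Proof.
move=> quiv_a ok_targets tr_targets v u def_v.
have [ts def_ts] : exists ts, targets = map (@vertex_label k r) ts.
  elim: targets ok_targets {tr_targets} => [_ | l ls IHls /=]; first by exists [::].
  by case/andP=> /label_okP[w <-] /IHls [ts ->]; exists (w :: ts).
have trE w g : \tr (irreps w g) = label_mxtrace (vertex_label w) g.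
  by case: w => [|[]].
rewrite (mckay_quiver_of_traces (pchar'_group _ _) vertex_irrep_complete (ts := ts)
  (pchar_num _) quiv_a).
  rewrite def_ts count_map; apply: eq_count => w.
  by rewrite /= (inj_eq vertex_label_inj).
move=> g Dg; rewrite trE def_v tr_targets // def_ts big_map.
by apply: eq_bigr => w _; rewrite trE.
Qed.

Lemma mxtrace_varrho_reflect t s : (t <= m)%N -> {in D, forall g,
  \tr (varrho t (q + s) g) = \tr (varrho (m - t) s g)}.
Proof. by move=> le_tm; apply/mxtrace_rsim/varrho_reflect. Qed.

(** Two reflections: each lowers the second index by [q], and together they restore [t]. *)
Lemma mxtrace_varrho_period t s : (t <= m)%N -> {in D, forall g,
  \tr (varrho t (2 * q + s) g) = \tr (varrho t s g)}.
Proof.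
move=> le_tm g Dg; rewrite mul2n -addnn -addnA mxtrace_varrho_reflect //.
by rewrite mxtrace_varrho_reflect ?leq_subr // subKn.
Qed.

Section Arrows.
Variable a : vertex k r -> vertex k r -> nat.
Hypothesis quiv_a : mckay_quiver irreps (varrho 1 1) a.

(** Here and in the next lemmas, the tensor product may yield indices out of range; the trace
    hypotheses name the vertices that represent them. *)
Lemma arrows_from_alpha i t s : label_ok (Varrho t s) ->
    {in D, forall g, \tr (varrho 1 i.+1 g) = \tr (varrho t s g)} ->
  arrows_from a (Alpha i) [:: Varrho t s].
Proof.
move=> ok_ts tr_ts; apply: arrows_from_of_traces => //; first by move: ok_ts => /= ->.
by move=> g Dg; rewrite big_seq1 mxtrace_alpha_varrho // tr_ts.
Qed.

Lemma arrows_from_varrho1 s t' s' : (s < q)%N -> label_ok (Varrho t' s') ->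
    {in D, forall g, \tr (varrho 2 s.+1 g) = \tr (varrho t' s' g)} ->
  arrows_from a (Varrho 1 s)
    [:: Alpha s.+1; Alpha (2 ^ (k - 1) + s.+1); Varrho t' s'].
Proof.
move=> lt_sq ok' tr'; apply: arrows_from_of_traces => //.
  move: ok' => /= ->; rewrite expn2_4q expn2_2q /=.
  by apply/and3P; split=> //; move: lt_sq q_gt1; lia.
move=> g Dg; rewrite !big_cons big_nil /= addr0 -tr' // expn2_2q.
by rewrite mxtrace_varrho_varrho // mxtrace_varrho0 // addrA.
Qed.

(** At this end the term with [t = m] reflects to [varrho 0 (q + s.+1)], which splits into two
    [alpha]. For [s = q - 1] the second index is [4 * q = 2 ^ k] and wraps to 0. *)
Lemma arrows_from_varrho_last s t' s' : (s < q)%N -> label_ok (Varrho t' s') ->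
    {in D, forall g, \tr (varrho (2 * r - 1) s.+1 g) = \tr (varrho t' s' g)} ->
  arrows_from a (Varrho (2 * r) s)
    [:: Alpha ((q + s.+1) %% 2 ^ k); Alpha ((2 ^ (k - 1) + q + s.+1) %% 2 ^ k);
        Varrho t' s'].
Proof.
move=> lt_sq ok' tr'; apply: arrows_from_of_traces => //.
  by move: ok' => /= ->; rewrite !ltn_pmod ?expn_gt0.
move=> g Dg; rewrite !big_cons big_nil /= addr0 -tr' // !mxtrace_alpha_mod //.
rewrite expn2_2q -addnA addrA -mxtrace_varrho0 // mxtrace_varrho_reflect // subn0.
have def_2r : (2 * r = (2 * r - 1).+1)%N by move: hr; lia.
by rewrite [in LHS]def_2r mxtrace_varrho_varrho // -def_2r addrC.
Qed.

Lemma arrows_from_varrho_inner t s t1 s1 t2 s2 : (0 < t)%N ->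
    label_ok (Varrho t1 s1) -> label_ok (Varrho t2 s2) ->
    {in D, forall g, \tr (varrho (t - 1) s.+1 g) = \tr (varrho t1 s1 g)} ->
    {in D, forall g, \tr (varrho t.+1 s.+1 g) = \tr (varrho t2 s2 g)} ->
  arrows_from a (Varrho t s) [:: Varrho t1 s1; Varrho t2 s2].
Proof.
case: t => // t _ ok1 ok2 tr1 tr2; apply: arrows_from_of_traces => //.
  by move: ok1 ok2 => /= -> ->.
move=> g Dg; rewrite !big_cons big_nil /= addr0 mxtrace_varrho_varrho //.
by rewrite -tr1 // -tr2 // subn1.
Qed.

End Arrows.

End IrreducibleRepresentations.

Local Close Scope ring_scope.

Theorem mainTheorem3 (R : realType) (k r : nat) (hk : (2 < k)%N) (hr : (1 <= r)%N)
    (gT : finGroupType) (D : {group gT}) (x y : gT)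
    (hD : D_presentation k r D x y)
    (alpha : nat -> mx_representation R[i] D 1)
    (halpha : is_alpha k x y alpha)
    (varrho : nat -> nat -> mx_representation R[i] D 2)
    (hvarrho : is_varrho k r x y varrho) :
  let irreps := @vertex_irrep R[i] gT D k r alpha varrho in
  let natural := varrho 1 1 in
  let q := (2 ^ (k - 2))%N in
  [/\ complete_irreps irreps,
      exists a, mckay_quiver irreps natural a
    & forall a, mckay_quiver irreps natural a ->
      [/\ (* (1) *)
          [/\ forall i, (i <= q - 2)%N ->
                arrows_from a (Alpha i) [:: Varrho 1 i.+1],
              forall j, (j < q)%N ->
                arrows_from a (Alpha (q + j - 1)) [:: Varrho (2 * r) j],
              forall j, (j < q)%N ->
                arrows_from a (Alpha (2 ^ (k - 1) + j - 1)) [:: Varrho 1 j],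
              forall j, (j < q)%N ->
                arrows_from a (Alpha (3 * q + j - 1)) [:: Varrho (2 * r) j]
            & arrows_from a (Alpha (2 ^ k - 1)) [:: Varrho 1 0]],
          (* (2) *)
          [/\ forall s, (s < q - 1)%N ->
                arrows_from a (Varrho 1 s)
                  [:: Alpha s.+1; Alpha (2 ^ (k - 1) + s.+1); Varrho 2 s.+1],
              forall s, s = (q - 1)%N ->
                arrows_from a (Varrho 1 s)
                  [:: Alpha s.+1; Alpha (2 ^ (k - 1) + s.+1);
                      Varrho (2 * r - 1) 0]
            & mx_rsim (varrho 2 q) (varrho (2 * r - 1)%N 0%N)],
          (* (3) *)
          forall t, (1 < t < 2 * r)%N ->
          [/\ forall s, (s < q - 1)%N ->
                arrows_from a (Varrho t s)
                  [:: Varrho (t - 1) s.+1; Varrho t.+1 s.+1],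
              forall s, s = (q - 1)%N ->
                arrows_from a (Varrho t s)
                  [:: Varrho ((2 * r).+1 - (t - 1)) 0;
                      Varrho ((2 * r).+1 - t.+1) 0],
              mx_rsim (varrho (t - 1)%N q)
                (varrho ((2 * r).+1 - (t - 1))%N 0%N)
            & mx_rsim (varrho t.+1 q) (varrho ((2 * r).+1 - t.+1)%N 0%N)]
        & (* (4) *)
          [/\ forall s, (s < q - 1)%N ->
                arrows_from a (Varrho (2 * r) s)
                  [:: Alpha ((q + s.+1) %% 2 ^ k);
                      Alpha ((2 ^ (k - 1) + q + s.+1) %% 2 ^ k);
                      Varrho (2 * r - 1) s.+1],
              forall s, s = (q - 1)%N ->
                arrows_from a (Varrho (2 * r) s)
                  [:: Alpha ((q + s.+1) %% 2 ^ k);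
                      Alpha ((2 ^ (k - 1) + q + s.+1) %% 2 ^ k);
                      Varrho 2 0]
            & mx_rsim (varrho (2 * r - 1)%N q) (varrho 2 0%N)]]].
Proof.
move=> irreps natural q; pose m := (2 * r).+1.
have q1 : (1 < q)%N := q_gt1 hk; have q0 := ltnW q1.
have e2q : (2 ^ (k - 1) = 2 * q)%N := expn2_2q hk.
have e4q : (2 ^ k = 4 * q)%N := expn2_4q hk.
have tr_reflect := mxtrace_varrho_reflect hk hD hvarrho.
have tr_period := mxtrace_varrho_period hk hD hvarrho.
have pred_qK s : s = (q - 1)%N -> s.+1 = q by move=> ->; rewrite -subSn ?subn1.
(* For [s = q - 1] the targets have second index [q]; this brings them back to 0. *)
have reflect_q t u : (t <= m)%N -> (m - t = u)%N -> mx_rsim (varrho t q) (varrho u 0%N).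
  by move=> le_tm <-; rewrite -[q]addn0; apply: (varrho_reflect hk hD hvarrho).
have m1 : (m - 1 = 2 * r)%N by rewrite /m subn1.
have m2 : (m - 2 = 2 * r - 1)%N by rewrite /m subSS.
have m2r : (m - (2 * r - 1) = 2)%N by move: hr; rewrite /m; lia.
have le1m : (1 <= m)%N by [].
have le2m : (2 <= m)%N by move: hr; rewrite /m; lia.
have complete := vertex_irrep_complete hk hr hD halpha hvarrho.
split=> //.
  exact: (@mckay_quiver_exists _ _ R[i] (pchar'_group _ _) _ _ complete).
move=> a quiv_a.
have alphaP := arrows_from_alpha hk hr hD halpha hvarrho quiv_a.
have firstP := arrows_from_varrho1 hk hr hD halpha hvarrho quiv_a.
have innerP := arrows_from_varrho_inner hk hr hD halpha hvarrho quiv_a.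
have lastP := arrows_from_varrho_last hk hr hD halpha hvarrho quiv_a.
split.
- split=> [i le_i | j lt_jq | j lt_jq | j lt_jq |]; apply: alphaP => //.
  + by rewrite /= muln_gt0 hr /=; lia.
  + by rewrite /= lt_jq muln_gt0 hr leqnn.
  (* The target of [alpha i] is [varrho 1 i.+1]. In the successive ranges of [i], its second index
     is reduced by one reflection, one period, a period and a reflection, and two periods. *)
  + have -> : (q + j - 1).+1 = (q + j)%N by lia.
    by rewrite -m1; apply: tr_reflect.
  + by rewrite /= lt_jq muln_gt0 hr.
  + have -> : (2 ^ (k - 1) + j - 1).+1 = (2 * q + j)%N by rewrite e2q; lia.
    exact: tr_period.
  + by rewrite /= lt_jq muln_gt0 hr leqnn.
  + have -> : (3 * q + j - 1).+1 = (2 * q + (q + j))%N by lia.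
    move=> g Dg; rewrite tr_period // -m1.
    exact: tr_reflect.
  + by rewrite /= q0 muln_gt0 hr.
  + have -> : (2 ^ k - 1).+1 = (2 * q + (2 * q + 0))%N by rewrite e4q; lia.
    by move=> g Dg; rewrite !tr_period.
- split=> [s lt_s | s def_s |]; last exact: reflect_q.
  + by apply: firstP => //=; [lia | move: hr; lia].
  + apply: firstP => //=; [by lia | by move: hr; lia |].
    by rewrite (pred_qK _ def_s); apply/mxtrace_rsim/reflect_q.
- move=> t /andP[t_gt1 lt_t2r].
  have [le_t1 le_t2] : (t - 1 <= m)%N /\ (t.+1 <= m)%N by rewrite /m; lia.
  split=> [s lt_s | s def_s | |]; try exact: reflect_q.
  + by apply: innerP => //=; lia.
  + apply: innerP => //=; try by lia.
      by rewrite (pred_qK _ def_s); apply/mxtrace_rsim/reflect_q.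
    by rewrite (pred_qK _ def_s); apply/mxtrace_rsim/reflect_q.
- have le_2r1 : (2 * r - 1 <= m)%N by rewrite /m; lia.
  split=> [s lt_s | s def_s |]; last exact: reflect_q.
  + by apply: lastP => //=; [lia | move: hr; lia].
  + apply: lastP => //=; [by lia | by move: hr; lia |].
    by rewrite (pred_qK _ def_s); apply/mxtrace_rsim/reflect_q.
Qed.
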